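(* Let $k$ be a field with $\mathrm{char}(k)=0$, let $G$ be an additive ordered abelian group and let $\mathcal{F}$ be a family of well-ordered subsets of $G$. Consider the following conditions on $\mathcal{F}$: (S1) $g\in G$ implies $\{g\}\in\mathcal{F}$; (S2) $A\in\mathcal{F}$ and $B\subseteq A$ implies $B\in\mathcal{F}$; (S3) $A,B\in\mathcal{F}$ implies $A\cup B\in\mathcal{F}$; (S4) $\{0\}\in\mathcal{F}$; (A2) $A,B\in\mathcal{F}$ implies $A\oplus B\in\mathcal{F}$; (A4) $A\in\mathcal{F}$ and $A\subseteq G^{\geq 0}$ implies $\bigoplus_{n\in\mathbb{N}}A\in\mathcal{F}$; (A5) if $g\in G$ is such that $\{g\}\in\mathcal{F}$, then $\{-g\}\in\mathcal{F}$. Then the following hold: (i) The $k$-hull $k((\mathcal{F}))$ is a subfield of $\mathbb{K}$ if and only if $\mathcal{F}$ satisfies (S2), (S3), (S4), (A2), (A4) and (A5). (ii) The $k$-hull $k((\mathcal{F}))$ is a Hahn field in $\mathbb{K}$ if and only if $\mathcal{F}$ satisfies (S1), (S2), (S3), (A2) and (A4). Hence, if $k((\mathcal{F}))$ is a Hahn field in $\mathbb{K}$, then it is restriction closed and thus also truncation closed.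
   Context: Ordered abelian groups are totally ordered. $\mathbb{K}=k((G))$ denotes the field of generalised power series with coefficient field $k$ and value group $G$: the set of all functions $s\colon G\to k$ whose support $\mathrm{supp}(s)=\{g\in G\mid s(g)\neq 0\}$ is a well-ordered subset of $G$, with pointwise addition and product $(rs)(g)=\sum_{h\in G}r(h)s(g-h)$. For $g\in G$, $t^g\in\mathbb{K}$ is the function mapping $g$ to $1$ and everything else to $0$. A subfield $K$ of $\mathbb{K}$ is called a Hahn field in $\mathbb{K}$ if $\{\alpha t^g\mid \alpha\in k, g\in G\}\subseteq K$. The $k$-hull of $\mathcal{F}$ in $\mathbb{K}$ is the set $k((\mathcal{F}))=\{a\in\mathbb{K}\mid \mathrm{supp}(a)\in\mathcal{F}\}$. The $k$-hull $k((\mathcal{F}))$ is called restriction closed if $A\in\mathcal{F}$ and $B\subseteq A$ implies $B\in\mathcal{F}$; it is called truncation closed if $A\in\mathcal{F}$ and $B$ an initial segment of $A$ implies $B\in\mathcal{F}$. For $A,B\subseteq G$, $A\oplus B=\{a+b\mid a\in A, b\in B\}$, and $\bigoplus_{n\in\mathbb{N}}A=\{\sum_{i=1}^n a_i\mid n\in\mathbb{N}, a_1,\ldots,a_n\in A\}$ is the set of finite sums of elements of $A$, where $\mathbb{N}=\{0,1,\ldots\}$ (so the empty sum $0$ is included, and $\bigoplus_{n\in\mathbb{N}}\emptyset=\{0\}$). $G^{\geq 0}=\{g\in G\mid g\geq 0\}$. *)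

(* Defs.v *)
From mathcomp Require Import all_boot all_order all_algebra.
From mathcomp Require Import boolp classical_sets functions cardinality fsbigop.
From mathcomp Require Import wochoice.

Set Implicit Arguments.
Unset Strict Implicit.
Unset Printing Implicit Defensive.

Import Order.TTheory GRing.Theory Num.Theory.

Local Open Scope classical_set_scope.
Local Open Scope ring_scope.

(* An ordered abelian group structure on G: the library's porderZmodType is an
   abelian group with an unrelated partial order on it. *)
Definition ordered_group (G : porderZmodType) : Prop :=
  total (<=%R : rel G) /\ forall x y z : G, x <= y -> x + z <= y + z.

Section Sets.
Context {G : porderZmodType}.
Implicit Types (A B : set G) (F : set (set G)).

Definition well_ordered A : Prop := wo_chain (<=%R : rel G) [in A].

Definition nonneg : set G := [set g | 0 <= g].

Definition set_add A B : set G := [set a + b | a in A & b in B].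

Definition finite_sums A : set G :=
  [set s | exists n (a : 'I_n -> G), (forall i, A (a i)) /\ s = \sum_(i < n) a i].

Definition initial_segment B A : Prop :=
  B `<=` A /\ forall a b, A a -> B b -> a <= b -> B a.

Definition S1 F : Prop := forall g : G, F [set g].
Definition S2 F : Prop := forall A B, F A -> B `<=` A -> F B.
Definition S3 F : Prop := forall A B, F A -> F B -> F (A `|` B).
Definition S4 F : Prop := F [set 0].
Definition A2 F : Prop := forall A B, F A -> F B -> F (set_add A B).
Definition A4 F : Prop := forall A, F A -> A `<=` nonneg -> F (finite_sums A).
Definition A5 F : Prop := forall g : G, F [set g] -> F [set - g].

(* Closure properties of the k-hull of F; they depend on F only. *)
Definition restriction_closed F : Prop := forall A B, F A -> B `<=` A -> F B.
Definition truncation_closed F : Prop :=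
  forall A B, F A -> initial_segment B A -> F B.

End Sets.

Section Series.
Context {k : fieldType} {G : porderZmodType}.
Implicit Types (r s a : G -> k) (K : set (G -> k)).

Definition supp s : set G := [set g | s g != 0].

Definition series : set (G -> k) := [set s | well_ordered (supp s)].

(* The sum ranges over the finite set of h with r h * s (g - h) != 0: finite
   when r and s are series; the junk value 0 is only used outside [series]. *)
Definition series_mul r s : G -> k :=
  fun g => \sum_(h \in [set: G]) r h * s (g - h).

Definition tpow (g : G) : G -> k := fun h => (h == g)%:R.

(* The clauses of [divring_closed], with the operations of the field of series:
   addition is pointwise, the unit is t^0 and the product is [series_mul] (the
   ring structure that the library puts on G -> k is the pointwise one). *)
Record is_subfield K : Prop := IsSubfield {
  subfield_series : K `<=` series;
  subfield1 : K (tpow 0);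
  subfieldB : forall r s, K r -> K s -> K (r \- s);
  subfieldM : forall r s, K r -> K s -> K (series_mul r s);
  subfieldV : forall r, K r -> r <> (fun=> 0) ->
    exists2 s, K s & series_mul r s = tpow 0
}.

Definition is_hahn_field K : Prop :=
  is_subfield K /\ forall (c : k) (g : G), K (fun h => c * tpow g h).

End Series.

Definition hull (k : fieldType) (G : porderZmodType) (F : set (set G)) :
  set (G -> k) := [set a | series a /\ F (supp a)].

Arguments hull k {G} F.

(* Main.v *)
Require Import Defs.
From mathcomp Require Import all_boot all_order all_algebra.
From mathcomp Require Import finmap.
From mathcomp Require Import boolp classical_sets cardinality fsbigop wochoice.
Import Order.TTheory Num.Theory GRing.Theory.
Local Open Scope classical_set_scope.
Local Open Scope ring_scope.

(** Everything comes down to how the support of a series reacts to the field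
operations.

If the hull is a field, apply these operations to indicator series.  As k has
characteristic 0, nothing cancels where it should not: the series
1_A - (1_A + 1_B) has support B when B is a subset of A ([subfield_S2]), the
series 1_A + 1_B has support the union of A and B ([subfield_S3]), and the
coefficients of 1_A 1_B count decompositions a + b, so that its support is the
whole sumset ([subfield_A2]).  For (A4), put E = A minus 0; the inverse s of
1 - 1_E satisfies s = 1 + 1_E s, so its coefficients count the ways to write an
element as an ordered sum of elements of E, and its support is exactly the set
of finite sums ([supp_geometric]).

Conversely, the closure conditions provide members of F that contain the
supports of differences and products.  For the inverse of a nonzero r with
least exponent g0 and leading coefficient c, write r = c t^g0 (1 - e) with
supp e > 0, and solve s = 1 + e s ([exists_inverse]).  In general one needs
Neumann's lemma to know that the set M of finite sums of supp e is
well-ordered; here (A4) puts M in F, whose members are well-ordered by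
hypothesis.  This allows s to be defined by recursion along M
([geometric_solution]), each coefficient s(g) being determined by finitely
many s(g - h) with h > 0.

The statement on Hahn fields follows: (S1) says that the hull contains the
monomials, and it implies (S4) and (A5). *)

(** * Well-ordered subsets of an ordered group *)

Lemma wo_min {G : porderZmodType} {A B : set G} :
  well_ordered A -> B `<=` A -> B !=set0 ->
  exists2 m, B m & forall x, B x -> m <= x.
Proof.
move=> woA BA [x Bx].
case: (woA [in B]) => [y|//|m [[Bm lbm] _]].
- by rewrite !inE => /BA.
- by exists x; rewrite inE.
by exists m => [|y By]; [rewrite inE in Bm | apply: lbm; rewrite inE].
Qed.

Lemma well_ordered_sub {G : porderZmodType} {A B : set G} :
  B `<=` A -> well_ordered A -> well_ordered B.
Proof.
move=> BA woA C CB; apply: woA => x /CB.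
by rewrite !inE; exact: BA.
Qed.

Lemma ordered_ltD2r {G : porderZmodType} (oG : ordered_group G) (z x y : G) :
  (x + z < y + z) = (x < y).
Proof.
have imp (u v w : G) : u < v -> u + w < v + w.
  rewrite !lt_neqAle => /andP[nuv leuv].
  by rewrite (proj2 oG) // andbT (inj_eq (addIr w)).
apply/idP/idP => [|/imp//].
by move=> /imp-/(_ (- z)); rewrite !addrK.
Qed.

Lemma ordered_leD2r {G : porderZmodType} (oG : ordered_group G) (z x y : G) :
  (x + z <= y + z) = (x <= y).
Proof. by rewrite !le_eqVlt (inj_eq (addIr z)) ordered_ltD2r. Qed.

Lemma ordered_subr_lt {G : porderZmodType} (oG : ordered_group G) (g h : G) :
  0 < h -> g - h < g.
Proof.
move=> h0; rewrite -(ordered_ltD2r oG (h - g)).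
by rewrite addrC addrA subrK subrr addrC subrK.
Qed.

(** If C were infinite, take the largest x in C with finitely many elements of
C below it: the least element of C above x would also have finitely many. *)
Lemma finite_wo_cowo {G : porderZmodType} (C : set G) :
  well_ordered C ->
  (forall B, B `<=` C -> B !=set0 -> exists2 m, B m & forall x, B x -> x <= m) ->
  finite_set C.
Proof.
move=> woC maxC; apply: contrapT => infC.
pose below x := C `&` [set y | y < x].
pose D := C `&` [set x | finite_set (below x)].
have [m [Cm finm] maxm] : exists2 m, D m & forall x, D x -> x <= m.
  apply: maxC; first by move=> x [].
  have [|m Cm minm] := wo_min woC (@subset_refl _ C).
    exact: infinite_setN0.
  exists m; split=> //=.
  suff -> : below m = set0 by exact: finite_set0.
  by rewrite -subset0 => y [/minm/le_gtF /= ->].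
(* C' is the part of C above m; its least element m' is in D as well. *)
pose C' := C `\` (below m `|` [set m]).
have [m' [Cm' nm'] minm'] : exists2 m', C' m' & forall x, C' x -> m' <= x.
  apply: (wo_min woC) => [x []//|].
  apply: infinite_setN0; apply: infinite_setD => //.
  by rewrite finite_setU; split=> //; exact: finite_set1.
have : D m'.
  split=> //=; apply: (@sub_finite_set _ _ (below m `|` [set m])); last first.
    by rewrite finite_setU; split=> //; exact: finite_set1.
  move=> y [Cy ltym']; apply: contrapT => ny.
  by have /minm' : C' y by []; rewrite (lt_geF ltym').
move=> /maxm; rewrite le_eqVlt => /orP[/eqP m'm|ltm'm]; apply: nm'.
  by right.
by left.
Qed.

(** The reflection h |-> g - h reverses the order, so the set is well-ordered
as a subset of A and dually well-ordered through B.  This is why the product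
of two series is a finite sum in each degree. *)
Lemma finite_decompositions {G : porderZmodType} (oG : ordered_group G)
    (A B : set G) (g : G) :
  well_ordered A -> well_ordered B -> finite_set [set h | A h /\ B (g - h)].
Proof.
move=> woA woB; apply: finite_wo_cowo => //.
  by apply: well_ordered_sub woA => h [].
move=> X XC [x0 Xx0].
have [| |_ [m Xm <-] minm] := wo_min woB (B := [set g - h | h in X]).
- by move=> _ [h Xh <-]; case: (XC _ Xh).
- by exists (g - x0), x0.
exists m => // x Xx; have /minm : [set g - h | h in X] (g - x) by exists x.
rewrite -[g - m <= _](ordered_leD2r oG (m - g)) ![_ + (m - g)]addrC.
rewrite !addrA !subrK subrr.
by rewrite -[0 <= _](ordered_leD2r oG x) add0r subrK.
Qed.

Lemma well_ordered_ind {G : porderZmodType} (M : set G) (P : G -> Prop) :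
  well_ordered M ->
  (forall g, M g -> (forall h, M h -> h < g -> P h) -> P g) ->
  forall g, M g -> P g.
Proof.
move=> woM step g0 Mg0; apply: contrapT => nPg0.
have [| |m [Mm nPm] minm] := wo_min woM (B := M `\` P); first by move=> x [].
  by exists g0.
apply/nPm/step => // h Mh lthm; apply: contrapT => nPh.
by have := minm h (conj Mh nPh); rewrite (lt_geF lthm).
Qed.

(** * Finite sums of elements of a set *)

Lemma finite_sums0 {G : porderZmodType} (A : set G) : finite_sums A 0.
Proof.
by exists 0%N, (fun=> 0); split=> [[]//|]; rewrite big_ord0.
Qed.

Lemma finite_sumsD {G : porderZmodType} (A : set G) (a x : G) :
  A a -> finite_sums A x -> finite_sums A (a + x).
Proof.
move=> Aa [n [b [Ab ->]]].
exists n.+1, (fun i => oapp b a (unlift ord0 i)); split.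
  by move=> i; case: (unlift _ _).
rewrite big_ord_recl unlift_none; congr +%R.
by apply: eq_bigr => i _; rewrite liftK.
Qed.

Lemma finite_sums_ind {G : porderZmodType} (A P : set G) :
  P 0 -> (forall a x, A a -> P x -> P (a + x)) -> finite_sums A `<=` P.
Proof.
move=> P0 PD _ [n [a [Aa ->]]]; elim: n => [|n IH] in a Aa *.
  by rewrite big_ord0.
by rewrite big_ord_recl; apply: PD => //; apply: IH.
Qed.

(** * Supports and products of series *)

Definition indicator {k : fieldType} {G : porderZmodType} (A : set G) : G -> k :=
  fun g => (g \in A)%:R.

Lemma indicatorP {k : fieldType} {G : porderZmodType} (A : set G) (g : G) :
  @indicator k G A g = if g \in A then 1 else 0.
Proof. by rewrite /indicator; case: (_ \in _). Qed.

Lemma supp_indicator {k : fieldType} {G : porderZmodType} (A : set G) :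
  supp (@indicator k G A) = A.
Proof.
apply/seteqP; split=> g; rewrite /supp /= indicatorP.
  by case: ifPn; rewrite ?eqxx// inE.
by move=> /mem_set ->; exact: oner_neq0.
Qed.

Lemma supp_tpow {k : fieldType} {G : porderZmodType} (g : G) :
  supp (@tpow k G g) = [set g].
Proof.
apply/seteqP; split=> h; rewrite /supp /tpow /=.
  by case: (eqVneq h g) => //; rewrite eqxx.
by move=> ->; rewrite eqxx oner_neq0.
Qed.

Lemma series_mul_finite {k : fieldType} {G : porderZmodType}
    (oG : ordered_group G) (r s : G -> k) (g : G) :
  series r -> series s -> finite_set (supp (fun h => r h * s (g - h))).
Proof.
move=> rS sS; apply: sub_finite_set (finite_decompositions oG _ _ g rS sS).
by move=> h /=; rewrite /supp /= mulf_eq0 negb_or => /andP[].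
Qed.

(** Sums over two different supports can be compared once both are written over
a common finite set. *)
Lemma fsum_over {k : fieldType} {G : porderZmodType} (D : set G) (f : G -> k) :
  finite_set D -> supp f `<=` D ->
  \sum_(h \in [set: G]) f h = \sum_(h <- fset_set D) f h.
Proof.
move=> finD fD; rewrite -fsbig_finite//; apply/esym/fsbig_widen => // h [_ nDh].
by apply: contrapT => fh; apply/nDh/fD/eqP.
Qed.

Lemma fsum_neq0 {k : fieldType} {G : porderZmodType} (f : G -> k) :
  \sum_(h \in [set: G]) f h != 0 -> exists h, f h != 0.
Proof.
move=> /eqP nz; apply: contrapT => none; apply: nz; apply: fsbig1 => h _.
by apply: contrapT => fh; apply: none; exists h; apply/eqP.
Qed.

Lemma series_mulBl {k : fieldType} {G : porderZmodType}
    (oG : ordered_group G) (r r' s : G -> k) (g : G) :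
  series r -> series r' -> series s ->
  series_mul (r \- r') s g = series_mul r s g - series_mul r' s g.
Proof.
move=> rS r'S sS; rewrite /series_mul.
pose D := supp (fun h => r h * s (g - h)) `|` supp (fun h => r' h * s (g - h)).
have finD : finite_set D by rewrite finite_setU; split; exact: series_mul_finite.
rewrite !(fsum_over D)//.
- by rewrite -sumrB; apply: eq_bigr => h _; rewrite mulrBl.
- by move=> h; right.
- by move=> h; left.
move=> h; rewrite /supp /= mulrBl => nz; apply: contrapT => /not_orP[].
rewrite /supp /= => /negP; rewrite negbK => /eqP r0 /negP.
by rewrite negbK => /eqP r'0; rewrite r0 r'0 subrr eqxx in nz.
Qed.

Lemma series_mul_tpow {k : fieldType} {G : porderZmodType} (g : G) (s : G -> k) :
  series_mul (tpow g) s = fun x => s (x - g).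
Proof.
apply/funext => x; rewrite /series_mul.
have fin1 : finite_set [set g] by exact: finite_set1.
rewrite (fsum_over [set g])//.
  by rewrite -fsbig_finite// fsbig_set1 /tpow eqxx mul1r.
move=> h; rewrite /supp /tpow /=.
by case: (eqVneq h g) => //; rewrite mul0r eqxx.
Qed.

Lemma supp_series_mul {k : fieldType} {G : porderZmodType} (r s : G -> k) :
  supp (series_mul r s) `<=` set_add (supp r) (supp s).
Proof.
move=> g /fsum_neq0[h]; rewrite mulf_eq0 negb_or => /andP[rh sh].
by exists h => //; exists (g - h) => //; rewrite addrC subrK.
Qed.

(** * Natural numbers in a field of characteristic 0 *)

Definition natural {k : fieldType} (x : k) : Prop := exists n : nat, x = n%:R.

Lemma natural_sum {k : fieldType} {T : Type} (t : seq T) (f : T -> k) :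
  (forall h, natural (f h)) -> natural (\sum_(h <- t) f h).
Proof.
move=> natf; elim/big_ind: _ => [|_ _ [m ->] [n ->]|//]; first by exists 0%N.
by exists (m + n)%N; rewrite natrD.
Qed.

(** In characteristic 0, natural numbers do not cancel: this is what makes the
supports below as large as they can be. *)
Lemma naturalD_neq0 {k : fieldType} (char0 : [pchar k] =i pred0) (x y : k) :
  natural x -> natural y -> x != 0 -> x + y != 0.
Proof.
move=> [m ->] [n ->]; rewrite -natrD !((pcharf0P k).1 char0) -!lt0n.
by move=> m0; rewrite addn_gt0 m0.
Qed.

Lemma natural_fsum_neq0 {k : fieldType} (char0 : [pchar k] =i pred0)
    {G : porderZmodType} (f : G -> k) (h : G) :
  finite_set (supp f) -> (forall h, natural (f h)) -> f h != 0 ->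
  \sum_(h \in [set: G]) f h != 0.
Proof.
move=> finf natf fh; rewrite (fsum_over (supp f))//.
rewrite (big_rem h) /=; last by rewrite in_fset_set// inE.
by apply: naturalD_neq0 => //; exact: natural_sum.
Qed.

(** * The equation s = 1 + e s *)

(** In degree g the equation expresses s(g) through the s(g - h) with h in
supp e, and g - h < g.  Let M be the set of finite sums of supp e.  Outside M
all terms vanish, because M contains 0 and is closed under adding elements of
supp e, so well-founded recursion along M solves the equation. *)
Lemma geometric_solution {k : fieldType} {G : porderZmodType}
    (oG : ordered_group G) (e : G -> k) :
  (forall h, supp e h -> 0 < h) -> well_ordered (finite_sums (supp e)) ->
  exists2 s : G -> k, supp s `<=` finite_sums (supp e) &
    forall g, s g = tpow 0 g + series_mul e s g.
Proof.
set M := finite_sums _ => e_gt0 woM.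
pose prec h g := M h /\ h < g.
have prec_wf : well_founded prec.
  have AccM g : M g -> Acc prec g.
    move: g; apply: (well_ordered_ind M (Acc prec) woM) => g Mg IH.
    constructor => h [Mh lthg]; exact: IH.
  move=> g; constructor => h [Mh _]; exact: AccM.
pose body g (rec : forall h, prec h g -> k) : k :=
  if pselect (M g) then
    tpow 0 g + \sum_(h \in [set: G])
      e h * (if pselect (prec (g - h) g) is left p then rec (g - h) p else 0)
  else 0.
pose s := Fix prec_wf (fun=> k) body.
have sE g : s g = body g (fun h _ => s h).
  rewrite /s Fix_eq // => h f1 f2 eqf; congr (body h).
  by apply: functional_extensionality_dep => y; apply/funext => p.
have suppM : supp s `<=` M.
  move=> g; rewrite /supp /= sE /body.
  by case: (pselect (M g)) => //= _; rewrite eqxx.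
exists s => // g; have [Mg|nMg] := pselect (M g).
  rewrite sE /body; case: (pselect (M g)) => //= _; congr +%R.
  apply: eq_fsbigr => h _.
  have [->|eh] := eqVneq (e h) 0; first by rewrite !mul0r.
  congr *%R; case: pselect => // nprec; apply/esym/eqP/negPn/negP => /suppM Mgh.
  by apply: nprec; split=> //; exact/ordered_subr_lt/e_gt0.
have s0 h : ~ M h -> s h = 0 by rewrite sE /body; case: (pselect (M h)).
rewrite s0// /tpow; case: eqP => [g0|_].
  by exfalso; apply: nMg; rewrite g0; exact: finite_sums0.
rewrite add0r /series_mul fsbig1// => h _.
have [->|eh] := eqVneq (e h) 0; first by rewrite mul0r.
rewrite s0 ?mulr0// => Mgh; apply: nMg.
by rewrite -(subrK h g) addrC; exact: finite_sumsD.
Qed.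

(** The equation forces s(g) to be the number of ways to write g as an ordered
sum of elements of E.  It is enough to know that s(g) is a natural number:
then the terms of s(a + x) = ... + 1_E(a) s(x) + ... cannot cancel. *)
Lemma supp_geometric {k : fieldType} (char0 : [pchar k] =i pred0)
    {G : porderZmodType} (oG : ordered_group G) (E : set G) (s : G -> k) :
  (forall h, E h -> 0 < h) -> well_ordered E -> series s ->
  (forall g, s g = tpow 0 g + series_mul (indicator E) s g) ->
  supp s = finite_sums E.
Proof.
move=> E_gt0 woE sS sE.
have nat_bool (b : bool) : natural (b%:R : k) by exists b.
have nat_s g : natural (s g).
  have [->|] := eqVneq (s g) 0; first by exists 0%N.
  move: g; apply: (well_ordered_ind _ (fun g => natural (s g)) sS) => g _ IH.
  rewrite sE.
  have [m ->] : natural (tpow 0 g : k) by exact: nat_bool.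
  have [n ->] : natural (series_mul (indicator E) s g).
    apply: natural_sum => h; rewrite indicatorP.
    case: ifPn => [|_]; last by exists 0%N; rewrite mul0r.
    rewrite inE mul1r => Eh.
    have [->|sgh] := eqVneq (s (g - h)) 0; first by exists 0%N.
    by apply: IH => //; exact/ordered_subr_lt/E_gt0.
  by exists (m + n)%N; rewrite natrD.
have nat_term g h : natural ((indicator E : G -> k) h * s (g - h)).
  have [m ->] : natural ((indicator E : G -> k) h) by exact: nat_bool.
  by have [n ->] := nat_s (g - h); exists (m * n)%N; rewrite natrM.
apply/seteqP; split.
  apply: (well_ordered_ind _ (finite_sums E) sS) => g.
  rewrite /supp /= sE /tpow => + IH.
  case: (g =P 0) => [->|_]; first by move=> _; exact: finite_sums0.
  rewrite add0r => /fsum_neq0[h]; rewrite mulf_eq0 negb_or => /andP[Eh sgh].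
  have {}Eh : E h by rewrite -(@supp_indicator k _ E).
  rewrite -(subrK h g) addrC; apply: finite_sumsD => //.
  by apply: IH => //; exact/ordered_subr_lt/E_gt0.
apply: finite_sums_ind; rewrite /supp /=.
  rewrite sE /tpow eqxx; apply: naturalD_neq0 => //.
  - exact: natural_sum.
  - exact: oner_neq0.
move=> a x Ea sx; rewrite sE addrC; apply: naturalD_neq0 => //.
- exact: natural_sum.
- exact: nat_bool.
apply: (natural_fsum_neq0 char0 (fun h => indicator E h * s (a + x - h)) a) => //.
  by apply: series_mul_finite => //; rewrite /series /= supp_indicator.
by rewrite indicatorP mem_set// mul1r addrC addKr.
Qed.

(** * Closure conditions that make the hull a field *)

Lemma well_ordered1 {G : porderZmodType} (g : G) : well_ordered [set g].
Proof.
apply: antisymmetric_wo_chain => [x y _ _|A Ag [x Ax]]; first exact: le_anti.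
exists x; split=> // y Ay; move: (Ag _ Ax) (Ag _ Ay).
by rewrite !inE => -> ->.
Qed.

Lemma hull_supp {k : fieldType} {G : porderZmodType} (F : set (set G))
    (F_wo : forall A, F A -> well_ordered A) (a : G -> k) :
  hull k F a <-> F (supp a).
Proof. by split=> [[]//|Fa]; split=> //; exact: F_wo. Qed.

Lemma hull_indicator {k : fieldType} {G : porderZmodType} (F : set (set G))
    (F_wo : forall A, F A -> well_ordered A) (A : set G) :
  F A -> hull k F (indicator A).
Proof. by move=> FA; apply/hull_supp; rewrite ?supp_indicator. Qed.

(** With g0 the least exponent of r and c = r(g0), the series
e = 1 - c^-1 t^(- g0) r has positive support, and c^-1 t^(- g0) (1 - e)^-1 is
the inverse of r.  Multiplication by t^(- g0) is written as the translation
x |-> x + g0 of the argument. *)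
Lemma exists_inverse {k : fieldType} {G : porderZmodType}
    (oG : ordered_group G) (F : set (set G))
    (F_wo : forall A, F A -> well_ordered A) (r : G -> k) :
  S2 F -> A2 F -> A4 F -> A5 F -> F (supp r) -> r <> (fun=> 0) ->
  exists2 s, F (supp s) & series_mul r s = tpow 0.
Proof.
move=> s2 a2 a4 a5 Fr r_neq0.
have [|g0 rg0 min_g0] := wo_min (F_wo _ Fr) (@subset_refl _ _).
  apply: contrapT => r0; apply/r_neq0/funext => g.
  by apply: contrapT => /eqP rg; apply: r0; exists g.
set c := r g0; have c_neq0 : c != 0 by [].
have FNg0 : F [set - g0] by apply/a5/(s2 _ _ Fr) => _ ->.
pose e : G -> k := tpow 0 \- (fun x => c^-1 * r (x + g0)).
have supp_e x : supp e x -> x != 0 /\ supp r (x + g0).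
  rewrite /supp /e /tpow /=; case: (x =P 0) => [->|_].
    by rewrite add0r mulVf// subrr eqxx.
  by rewrite sub0r oppr_eq0 mulf_eq0 negb_or => /andP[].
have e_gt0 x : supp e x -> 0 < x.
  move=> /supp_e[x0 /min_g0]; rewrite lt_neqAle eq_sym x0 /=.
  by rewrite -{1}(add0r g0) (ordered_leD2r oG).
have Fe : F (supp e).
  apply: s2 (a2 _ _ Fr FNg0) _ => x /supp_e[_ rx].
  by exists (x + g0) => //; exists (- g0) => //; rewrite addrK.
have FM : F (finite_sums (supp e)).
  by apply: a4 Fe _ => x /e_gt0/ltW.
have [s suppM sE] := geometric_solution oG e e_gt0 (F_wo _ FM).
exists (fun x => c^-1 * s (x + g0)).
  apply: s2 (a2 _ _ FM FNg0) _ => x; rewrite /supp /= mulf_eq0 negb_or.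
  move=> /andP[_ /suppM Mx].
  by exists (x + g0) => //; exists (- g0) => //; rewrite addrK.
apply/funext => x.
have -> : series_mul r (fun x => c^-1 * s (x + g0)) x =
          series_mul (tpow 0 \- e) s x.
  rewrite /series_mul (reindex_fsbigT (fun h => h + g0)) /=; last first.
    by exists (fun h => h - g0) => h; rewrite ?addrK ?subrK.
  apply: eq_fsbigr => h _.
  by rewrite /e /= subKr opprD addrA subrK mulrA [r _ * _]mulrC.
rewrite series_mulBl//.
- by rewrite series_mul_tpow subr0 sE addrK.
- by rewrite /series /= supp_tpow; exact: well_ordered1.
- exact: F_wo.
- by apply: well_ordered_sub suppM _; exact: F_wo.
Qed.

Lemma hull_subfield {k : fieldType} {G : porderZmodType}
    (oG : ordered_group G) (F : set (set G))
    (F_wo : forall A, F A -> well_ordered A) :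
  S2 F -> S3 F -> S4 F -> A2 F -> A4 F -> A5 F -> is_subfield (hull k F).
Proof.
move=> s2 s3 s4 a2 a4 a5; split.
- by move=> r [].
- by apply/hull_supp; rewrite ?supp_tpow.
- move=> r s [_ Fr] [_ Fs]; apply/hull_supp => //.
  apply: s2 (s3 _ _ Fr Fs) _ => g; rewrite /supp /= => rs.
  apply: contrapT => /not_orP[/negP + /negP]; rewrite !negbK => /eqP r0 /eqP s0.
  by rewrite r0 s0 subrr eqxx in rs.
- move=> r s [_ Fr] [_ Fs]; apply/hull_supp => //.
  exact: s2 (a2 _ _ Fr Fs) (@supp_series_mul _ _ _ _).
- move=> r [_ Fr] r_neq0.
  have [s Fs rs] := exists_inverse oG F F_wo r s2 a2 a4 a5 Fr r_neq0.
  by exists s => //; apply/hull_supp.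
Qed.

(** * Closure conditions forced by a field *)

(** The coefficients of 1_A + 1_B are 1 and 2, both nonzero on A, and
subtracting this series from 1_A leaves -1_B. *)
Lemma subfield_S2 {k : fieldType} (char0 : [pchar k] =i pred0)
    {G : porderZmodType} (F : set (set G))
    (F_wo : forall A, F A -> well_ordered A) :
  is_subfield (hull k F) -> S2 F.
Proof.
move=> sK A B FA BA.
have two_neq0 : 1 + 1 != 0 :> k.
  by rewrite -[1 + 1]/(2%:R) ((pcharf0P k).1 char0).
pose s : G -> k := fun g => indicator A g + indicator B g.
have Ks : hull k F s.
  apply/hull_supp => //; suff -> : supp s = A by [].
  apply/seteqP; split=> g; rewrite /supp /s /= !indicatorP.
    case: ifPn => [/set_mem//|nA]; rewrite ifN ?addr0 ?eqxx//.
    by apply: contra nA; rewrite !inE; exact: BA.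
  move=> /mem_set ->; case: ifP => // _; by rewrite addr0 oner_neq0.
have [_] := subfieldB sK (hull_indicator F F_wo A FA) Ks.
suff -> : supp (indicator A \- s) = B by [].
rewrite -[RHS](@supp_indicator k); apply/funext => g; rewrite /supp /s /=.
by rewrite opprD addrA subrr sub0r oppr_eq0.
Qed.

Lemma subfield_S3 {k : fieldType} (char0 : [pchar k] =i pred0)
    {G : porderZmodType} (F : set (set G))
    (F_wo : forall A, F A -> well_ordered A) :
  is_subfield (hull k F) -> S3 F.
Proof.
move=> sK A B FA FB.
have nat_ind (C : set G) g : natural (indicator C g : k) by exists (g \in C).
have supp_opp : supp (fun g => - (indicator B g : k)) = B.
  rewrite -[RHS](@supp_indicator k); apply/funext => g.
  by rewrite /supp /= oppr_eq0.
have KNB : hull k F (fun g => - indicator B g).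
  by apply/hull_supp; rewrite ?supp_opp.
have [_] := subfieldB sK (hull_indicator F F_wo A FA) KNB.
congr F; rewrite -{2}(@supp_indicator k _ A) -{2}(@supp_indicator k _ B).
apply/seteqP; split=> g; rewrite /supp /= opprK.
  move=> nz; apply: contrapT => /not_orP[/negP + /negP].
  by rewrite !negbK => /eqP A0 /eqP B0; rewrite A0 B0 addr0 eqxx in nz.
case; last rewrite addrC; exact: naturalD_neq0.
Qed.

Lemma subfield_A2 {k : fieldType} (char0 : [pchar k] =i pred0)
    {G : porderZmodType} (oG : ordered_group G) (F : set (set G))
    (F_wo : forall A, F A -> well_ordered A) :
  is_subfield (hull k F) -> A2 F.
Proof.
move=> sK A B FA FB.
have [_] := subfieldM sK (hull_indicator F F_wo A FA)
                         (hull_indicator F F_wo B FB).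
congr F; apply/seteqP; split=> [g /supp_series_mul|].
  by rewrite !supp_indicator.
move=> _ [a Aa [b Bb <-]].
pose f h : k := indicator A h * indicator B (a + b - h).
apply: (natural_fsum_neq0 char0 f a).
- by apply: (series_mul_finite oG) => //; rewrite /series /= supp_indicator;
    exact: F_wo.
- by move=> h; exists ((h \in A) * ((a + b - h)%R \in B))%N; rewrite natrM.
- by rewrite /f [a + b]addrC addrK !indicatorP !mem_set// mulr1 oner_neq0.
Qed.

(** Removing 0 from A does not change the set of finite sums and makes
1 - 1_E a nonzero series with constant coefficient 1. *)
Lemma subfield_A4 {k : fieldType} (char0 : [pchar k] =i pred0)
    {G : porderZmodType} (oG : ordered_group G) (F : set (set G))
    (F_wo : forall A, F A -> well_ordered A) :
  is_subfield (hull k F) -> A4 F.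
Proof.
move=> sK A FA A_ge0; pose E := A `\ 0.
have FE : F E by apply: (subfield_S2 char0 F F_wo sK A) => // g [].
have E_gt0 h : E h -> 0 < h.
  by move=> [/A_ge0 h0 /eqP hn0]; rewrite lt_neqAle eq_sym hn0.
have KE := hull_indicator (k := k) F F_wo E FE.
have serE : series (indicator E : G -> k) by case: KE.
have ser1 : series (tpow 0 : G -> k) by case: (subfield1 sK).
have [|s [serS Fs] es1] := subfieldV sK (subfieldB sK (subfield1 sK) KE).
  move=> /(congr1 (fun f => f 0)) /=; rewrite indicatorP /tpow eqxx.
  rewrite memNset ?subr0; last by move=> [_]; apply.
  exact/eqP/oner_neq0.
have sE g : s g = tpow 0 g + series_mul (indicator E) s g.
  move: (congr1 (fun f => f g) es1); rewrite series_mulBl//.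
  rewrite series_mul_tpow subr0.
  by move=> <-; rewrite subrK.
rewrite (supp_geometric char0 oG E s E_gt0 (F_wo _ FE) serS sE) in Fs.
suff -> : finite_sums A = finite_sums E by [].
apply/seteqP; split; apply: finite_sums_ind; try exact: finite_sums0.
- move=> a x Aa Ex; have [->|a0] := eqVneq a 0; first by rewrite add0r.
  by apply: finite_sumsD => //; split=> //; exact/eqP.
- by move=> a x [Aa _]; exact: finite_sumsD.
Qed.

(** The inverse of t^g is t^(- g). *)
Lemma subfield_A5 {k : fieldType} {G : porderZmodType} (F : set (set G))
    (F_wo : forall A, F A -> well_ordered A) :
  is_subfield (hull k F) -> A5 F.
Proof.
move=> sK g Fg.
have Kg : hull k F (tpow g) by apply/hull_supp; rewrite ?supp_tpow.
have [|s [_ Fs] ts1] := subfieldV sK Kg.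
  move=> /(congr1 (fun f => f g)); rewrite /tpow eqxx; exact/eqP/oner_neq0.
suff -> : [set - g] = supp s by [].
rewrite -(@supp_tpow k); congr supp; apply/funext => x.
move: (congr1 (fun f => f (x + g)) ts1).
by rewrite series_mul_tpow addrK => ->; rewrite /tpow -(inj_eq (addIr g)) addNr.
Qed.

Theorem proposition3p15 (k : fieldType) (char0 : [pchar k] =i pred0)
    (G : porderZmodType) (G_ordered : ordered_group G)
    (F : set (set G)) (F_wo : forall A : set G, F A -> well_ordered A) :
  (is_subfield (hull k F) <-> [/\ S2 F, S3 F, S4 F & [/\ A2 F, A4 F & A5 F]]) /\
  (is_hahn_field (hull k F) <-> [/\ S1 F, S2 F, S3 F, A2 F & A4 F]) /\
  (is_hahn_field (hull k F) -> restriction_closed F /\ truncation_closed F).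
Proof.
have subfield_iff : is_subfield (hull k F) <->
    [/\ S2 F, S3 F, S4 F & [/\ A2 F, A4 F & A5 F]].
  split=> [sK|[s2 s3 s4 [a2 a4 a5]]]; last exact: hull_subfield.
  split; last split.
  - exact: (subfield_S2 char0 F F_wo sK).
  - exact: (subfield_S3 char0 F F_wo sK).
  - by have [_] := subfield1 sK; rewrite supp_tpow.
  - exact: (subfield_A2 char0 G_ordered F F_wo sK).
  - exact: (subfield_A4 char0 G_ordered F F_wo sK).
  - exact: (subfield_A5 F F_wo sK).
have hahn_iff : is_hahn_field (hull k F) <-> [/\ S1 F, S2 F, S3 F, A2 F & A4 F].
  split=> [[/subfield_iff[s2 s3 _ [a2 a4 _]] monomials]|[s1 s2 s3 a2 a4]].
    split=> // g; have [_] := monomials 1 g.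
    suff -> : (fun h => 1 * tpow g h) = tpow g :> (G -> k) by rewrite supp_tpow.
    by apply/funext => h; rewrite mul1r.
  split; first by apply/subfield_iff; split=> //; split=> // g _.
  move=> c g; apply/hull_supp => //; apply: s2 (s1 g) _ => h.
  by rewrite -(@supp_tpow k) /supp /= mulf_eq0 negb_or => /andP[].
split=> //; split=> // /hahn_iff[_ s2 _ _ _]; split=> //.
by move=> A B FA [BA _]; exact: s2 FA BA.
Qed.
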